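(* Suppose $F_u$ is continuous. For any $\varepsilon,\delta\in(0,1)$, $$P\{P\{\hat u_1<u(q)\le\hat u_N\}\ge 1-\varepsilon\}\ge 1-\delta$$ if and only if $\mu(N)\le\delta$, where $$\mu(N):=(1-\varepsilon)^{N-1}\,[1+(N-1)\varepsilon]$$ is a monotonically decreasing function of the positive integer $N$.
   Context: Let $q$ be a random vector taking values in a compact set $\mathcal{Q}$, with a multivariate probability density function, and let $u$ be a real-valued measurable function of $q$. Write $F_u(\gamma):=P\{u(q)\le\gamma\}$, $\gamma\in\mathbb{R}$, for the cumulative distribution function of $u(q)$. Let $N\geq 1$, let $q^1,\dots,q^N$ be i.i.d. samples with the same distribution as $q$, and let $\hat u_i$ ($1\le i\le N$) be the $i$-th smallest of $u(q^1),\dots,u(q^N)$, so $\hat u_1\le\hat u_2\le\cdots\le\hat u_N$ (order statistics). In the nested probability, the inner probability is over $q$ with the values of the order statistics held fixed (i.e. $q$ is independent of the samples), so $P\{\hat u_1<u(q)\le\hat u_N\}$ means the random variable $F_u(\hat u_N)-F_u(\hat u_1)$. The outer probability is over the samples $q^1,\dots,q^N$. *)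

(* Defs.v *)
From HB Require Import structures.
From mathcomp Require Import all_boot all_order all_algebra.
From mathcomp Require Import all_classical all_reals all_analysis.

Set Implicit Arguments.
Unset Strict Implicit.
Unset Printing Implicit Defensive.

Import Order.TTheory GRing.Theory Num.Theory.
Import numFieldNormedType.Exports.

Local Open Scope classical_set_scope.
Local Open Scope ring_scope.

(* R^n is the type n.-tuple R, which carries the product (Borel)
   sigma-algebra. Tuples have no canonical topology, so compactness is read in
   'rV[R]_n along the coordinate bijection. *)
Definition row_of_tuple (R : realType) (n : nat) (x : n.-tuple R) : 'rV[R]_n :=
  \row_i tnth x i.

Definition compact_tuple (R : realType) (n : nat) (Q : set (n.-tuple R)) :=
  compact (@row_of_tuple R n @` Q).

Definition cons_pair (R : realType) (n : nat)
    (z : measurableTypeR R * n.-tuple R) : n.+1.-tuple R :=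
  [the n.+1.-tuple R of (z.1 : R) :: z.2].

Lemma measurable_cons_pair (R : realType) (n : nat) :
  measurable_fun setT (@cons_pair R n).
Proof. exact: (@measurable_cons _ _ _ R fst n snd). Qed.

Definition lebesgue_cons (R : realType) (n : nat)
    (m : {measure set (n.-tuple R) -> \bar R}) :
    {measure set (n.+1.-tuple R) -> \bar R} :=
  measure_function_pushforward__canonical__measure_function_Measure
    (@lebesgue_measure R \x^ m)%E (@measurable_cons_pair R n).

(* Lebesgue measure on R^n: the n-fold product of the one-dimensional one,
   transported from R * R^n to R^n.+1; R^0 is a point of mass 1. *)
Fixpoint lebesgue_tuple (R : realType) (n : nat) :
    {measure set (n.-tuple R) -> \bar R} :=
  match n with
  | 0 => \d_ ([tuple] : 0.-tuple R)
  | m.+1 => lebesgue_cons (lebesgue_tuple R m)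
  end.

Lemma measurable_box (R : realType) (n : nat) (B : 'I_n -> set R) :
  (forall i, measurable (B i)) ->
  measurable [set x : n.-tuple R | forall i, B i (tnth x i)].
Proof.
move=> mB.
rewrite (_ : [set x | _] =
    \bigcap_(i in [set: 'I_n]) ((fun x : n.-tuple R => tnth x i) @^-1` B i)).
  apply: fin_bigcap_measurable => // i _.
  by rewrite -[X in measurable X]setTI; exact: measurable_tnth.
by apply/seteqP; split => x /= H i; [move=> _|]; exact: H.
Qed.

Lemma lebesgue_tuple_box (R : realType) (n : nat) (B : 'I_n -> set R) :
  (forall i, measurable (B i)) ->
  lebesgue_tuple R n [set x | forall i, B i (tnth x i)] =
  (\prod_(i < n) @lebesgue_measure R (B i))%E.
Proof.
elim: n B => [|n IH] B mB /=.
  rewrite big_ord0 diracE (_ : [tuple] \in _ = true) //.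
  by apply/mem_set => -[].
rewrite big_ord_recl -IH; last by move=> i; exact: mB.
rewrite -product_measure2E //=.
- congr product_measure2; apply/seteqP; split => -[x t] /=.
    move=> H; split; first by have := H ord0; rewrite tnth0.
    by move=> i; have := H (lift ord0 i); rewrite tnthS.
  case=> B0 Bt i; case: (unliftP ord0 i) => [j ->|->].
    by rewrite tnthS; exact: Bt.
  by rewrite tnth0.
- exact: mB.
- by apply: (@measurable_box R n (fun i => B (lift ord0 i))) => i; exact: mB.
Qed.

Definition has_density d (T : measurableType d) (R : realType) (n : nat)
    (P : probability T R) (X : {RV P >-> n.-tuple R}) :=
  exists f : n.-tuple R -> R,
    [/\ measurable_fun setT f, forall x, 0 <= f x
      & forall A, measurable A ->
          distribution P X A = (\int[lebesgue_tuple R n]_(x in A) (f x)%:E)%E].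

Definition identically_distributed d d' d'' (T : measurableType d)
    (T' : measurableType d') (S : measurableType d'') (R : realType)
    (P : probability T R) (P' : probability T' R)
    (X : {RV P >-> S}) (Y : {RV P' >-> S}) :=
  forall A, measurable A -> distribution P X A = distribution P' Y A.

Definition mutually_independent d d' (T : measurableType d)
    (S : measurableType d') (R : realType) (I : finType) (P : probability T R)
    (X : I -> {RV P >-> S}) :=
  forall (J : {set I}) (B : I -> set S), (forall i, measurable (B i)) ->
    P (\bigcap_(i in [set` J]) (X i @^-1` B i)) =
    (\prod_(i in J) P (X i @^-1` B i))%E.

Definition cdf_of d (T : measurableType d) (R : realType)
    (P : probability T R) (Y : T -> R) (g : R) : R :=
  fine (P [set w | Y w <= g]).

(* The index k counts from 1: order_stat x 1 is the minimum of x and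
   order_stat x N its maximum. *)
Definition order_stat (R : realType) (N : nat) (x : 'I_N -> R) (k : nat) : R :=
  (sort <=%R [seq x i | i <- enum 'I_N])`_k.-1.

(* Meaningful for N >= 1 only: N.-1 truncates at 0. *)
Definition mu (R : realType) (eps : R) (N : nat) : R :=
  (1 - eps) ^+ N.-1 * (1 + N.-1%:R * eps).

(* Main.v *)
Require Import Defs.
From HB Require Import structures.
From mathcomp Require Import all_boot all_order all_algebra.
From mathcomp Require Import all_classical all_reals all_analysis.
From mathcomp Require Import measurable_realfun.
From mathcomp Require Import ring lra.

(** As [F_u] is continuous, the variables [U_i := F_u (u (qs i))] are i.i.d.
    uniform on [0, 1], and the inner probability is their range
    [max U_i - min U_i], so everything reduces to showing that the range is
    below [r := 1 - eps] with probability [mu N]. No joint density is needed: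
    the event "range < r and min U_i in [x, x + h[" is sandwiched between
    differences of boxes,
<<
      [x, x + r[^N     \ [x + h, x + r[^N
      [x, x + h + r[^N \ [x + h, x + h + r[^N
>>
    of probabilities r^N - (r - h)^N and (r + h)^N - r^N, both
    h N r^(N-1) + o(h). Summing over x in a grid of mesh h of [0, 1 - r] and
    letting h tend to 0 gives (1 - r) N r^(N-1), while "range < r and
    min U_i >= 1 - r" has probability r^N. *)

Set Implicit Arguments.
Unset Strict Implicit.
Unset Printing Implicit Defensive.

Import Order.TTheory GRing.Theory Num.Theory.
Import numFieldNormedType.Exports.

Local Open Scope classical_set_scope.
Local Open Scope ring_scope.

(** * Borel measurability of compact sets in [n.-tuple R] *)

(** The image of [Q] among row vectors is closed, so the complement of [Q] is a countable union of
    open boxes with rational endpoints. This is needed because [u] is assumed measurable on [Q]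
    only. *)
Lemma compact_tuple_measurable (R : realType) (n : nat) (Q : set (n.-tuple R)) :
  compact_tuple Q -> measurable Q.
Proof.
move=> cQ.
have oQ : open (~` (@row_of_tuple R n @` Q)).
  by apply: closed_openC; apply: compact_closed cQ; exact: norm_hausdorff.
pose box (p : n.-tuple (rat * rat)) := [set x : n.-tuple R |
  forall i, [set` `]ratr (tnth p i).1, ratr (tnth p i).2[] (tnth x i)].
(* A box that meets [Q] is replaced by the empty set, so the union can run over the whole countable
   type of rational endpoints. *)
pose F p := if `[< box p `&` Q = set0 >] then box p else set0.
have -> : Q = ~` (\bigcup_p F p).
  apply/seteqP; split => [x Qx [p _]|x nFx].
    rewrite /F; case: asboolP => // bQ bx.
    by have : (box p `&` Q) x by []; rewrite bQ.
  apply: contrapT => nQx; apply: nFx.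
  have /nbhs_ballP[e /= e0 xe] :
      nbhs (row_of_tuple x) (~` (@row_of_tuple R n @` Q)).
    apply: open_nbhs_nbhs; split=> // -[y Qy /rowP yx]; apply: nQx.
    suff <- : y = x by [].
    by apply: eq_from_tnth => i; have := yx i; rewrite !mxE.
  (* Endpoints within [e] of each coordinate, on either side, place the box around [x] inside the
     [e]-ball, which misses [Q]. *)
  have ratP i : exists p : rat * rat,
      tnth x i - e < ratr p.1 < tnth x i /\ tnth x i < ratr p.2 < tnth x i + e.
    have [|a Ha] := @rat_in_itvoo R (tnth x i - e) (tnth x i); first by lra.
    have [|b Hb] := @rat_in_itvoo R (tnth x i) (tnth x i + e); first by lra.
    by exists (a, b); move: Ha Hb; rewrite !in_itv.
  have [f fP] := choice ratP.
  exists [tuple f i | i < n] => //; rewrite /F; case: asboolP => [_ i|].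
    by rewrite /= tnth_mktuple in_itv /=; have [/andP[_ ->] /andP[-> _]] := fP i.
  case; apply/seteqP; split=> // y [bxy Qy].
  suff yx : ball (row_of_tuple x) e (row_of_tuple y) by apply: (xe _ yx); exists y.
  split=> // j i; rewrite !mxE /ball /=.
  have := bxy i; rewrite /= tnth_mktuple in_itv /=.
  have [/andP[h1 h2] /andP[h3 h4]] := fP i.
  by move=> /andP[h5 h6]; rewrite ltr_distl; apply/andP; split; lra.
apply: measurableC; apply: countable_bigcupT_measurable.
  exact: countableP.
move=> p; rewrite /F; case: asboolP => // _.
apply: (@measurable_box R n
  (fun i => [set` `]ratr (tnth p i).1, ratr (tnth p i).2[])) => i.
exact: measurable_itv.
Qed.

(** * Order statistics *)

Lemma order_statP (R : realType) (N : nat) (x : 'I_N -> R) (k : nat) :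
  (0 < k <= N)%N -> exists i, order_stat x k = x i.
Proof.
move=> /andP[k0 kN]; rewrite /order_stat; set s := sort _ _.
have : s`_k.-1 \in s.
  by rewrite mem_nth // size_sort size_map size_enum_ord prednK.
by rewrite mem_sort => /mapP[i _ ->]; exists i.
Qed.

Lemma order_stat_bounds (R : realType) (N : nat) (x : 'I_N -> R) i :
  order_stat x 1 <= x i <= order_stat x N.
Proof.
rewrite /order_stat; set s := sort _ _.
have ss : sorted <=%R s by exact: sort_le_sorted.
have sz : size s = N by rewrite size_sort size_map size_enum_ord.
have xs : x i \in s by rewrite mem_sort map_f // mem_enum.
have Npos : (0 < N)%N := leq_ltn_trans (leq0n i) (ltn_ord i).
have ks : (index (x i) s < N)%N by rewrite -sz index_mem.
rewrite -(nth_index 0 xs) !(le_sorted_leq_nth _ ss) ?inE ?sz ?prednK //=.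
by rewrite -ltnS prednK.
Qed.

(** * Monotonicity of [mu] and increments of powers *)

(** Consecutive values compare through (1 - eps)(1 + (k+1) eps) = 1 + k eps - (k+1) eps^2. *)
Lemma mu_decreasing (R : realType) (eps : R) (M M' : nat) :
  0 < eps < 1 -> (1 <= M)%N -> (M < M')%N -> mu eps M' < mu eps M.
Proof.
move=> /andP[e0 e1].
have step k : mu eps k.+2 < mu eps k.+1.
  rewrite /mu /= exprS mulrAC mulrC ltr_pM2l ?exprn_gt0 ?subr_gt0 //.
  rewrite -natr1; have : 0 <= k%:R :> R by [].
  by move: k%:R => x x0; nra.
case: M M' => // M [//|M'] _; rewrite ltnS.
elim: M' => // M' IH; rewrite ltnS leq_eqVlt => /predU1P[->|/IH]; first exact: step.
exact: lt_trans.
Qed.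

(** The difference of powers factors as b - a times a sum of n+1 terms b^(n-i) a^i, each between a^n
    and b^n. *)
Lemma diff_exprn_bounds (R : realType) (a b : R) n : 0 <= a <= b ->
  n.+1%:R * a ^+ n * (b - a) <= b ^+ n.+1 - a ^+ n.+1
    <= n.+1%:R * b ^+ n * (b - a).
Proof.
move=> /andP[a0 ab]; have ba : 0 <= b - a by rewrite subr_ge0.
have b0 := le_trans a0 ab.
rewrite subrXX mulrC [_ * b ^+ n * _]mulrC !ler_wpM2l //.
  rewrite mulr_natl -[X in _ *+ X]card_ord -sumr_const; apply: ler_sum => i _.
  rewrite -[in leRHS](subnK (leq_ord i)) exprD ler_pM ?exprn_ge0 //.
  by rewrite lerXn2r ?nnegrE.
rewrite mulr_natl -[X in _ *+ X]card_ord -sumr_const; apply: ler_sum => i _.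
rewrite -[in leLHS](subnK (leq_ord i)) exprD ler_pM ?exprn_ge0 //.
by rewrite lerXn2r ?nnegrE.
Qed.

(** * Probability integral transform *)

Section uniform_cdf.
Context d (T : measurableType d) (R : realType) (P : probability T R).
Variable X : {RV P >-> R}.
Let F := cdf_of P X.
Hypothesis cF : continuous F.

Let cdfE x : (F x)%:E = P [set w | X w <= x].
Proof.
rewrite fineK // fin_num_measure //.
have -> : [set w | X w <= x] = X @^-1` `]-oo, x].
  by apply/seteqP; split => w; rewrite /= in_itv.
exact: measurable_sfunP.
Qed.

Let Fcdf x : F x = fine (cdf X x).
Proof.
rewrite /F /cdf_of; congr (fine (P _)).
Qed.

Let mX A : measurable A -> measurable (X @^-1` A).
Proof. exact: measurable_sfunP. Qed.

Lemma cdf_of_ge0 x : 0 <= F x. Proof. exact: fine_ge0. Qed.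

Lemma cdf_of_homo : {homo F : x y / x <= y}.
Proof.
by move=> x y xy; rewrite !Fcdf fine_le ?fin_num_measure// cdf_nondecreasing.
Qed.

Lemma measurable_cdf_of : measurable_fun setT F.
Proof. exact: nondecreasing_measurable cdf_of_homo. Qed.

Let mFX s : measurable [set w | F (X w) < s].
Proof.
rewrite (_ : [set _ | _] = X @^-1` (F @^-1` `]-oo, s[)).
  apply: mX; rewrite -[X in measurable X]setTI.
  by apply: measurable_cdf_of => //; exact: measurable_itv.
by apply/seteqP; split => w; rewrite /= in_itv.
Qed.

(** Intermediate value theorem between the limits 0 and 1 of the cdf at the two infinities. *)
Lemma cdf_of_attains s : 0 < s < 1 -> exists c, F c = s.
Proof.
move=> /andP[s0 s1].
have [b sb] : exists b, s < F b.
  have : F x @[x --> +oo] --> (1 : R).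
    rewrite (_ : F = fine \o cdf X); last by apply/funext => x; exact: Fcdf.
    by apply: fine_cvg; exact: cvg_cdfy1.
  by move=> /(cvgr_gt (1 : R)) /(_ _ s1) /filter_ex.
have [a sa] : exists a, F a < s.
  have : F x @[x --> -oo] --> (0 : R).
    rewrite (_ : F = fine \o cdf X); last by apply/funext => x; exact: Fcdf.
    by apply: fine_cvg; exact: cvg_cdfNy0.
  by move=> /(cvgr_lt (0 : R)) /(_ _ s0) /filter_ex.
have ab : a <= b.
  by rewrite leNgt; apply/negP => /ltW /cdf_of_homo; rewrite leNgt (lt_trans sa).
have [||c _ <-] := @IVT R F a b s ab; last by exists c.
  exact: continuous_subspaceT.
by rewrite min_l ?max_r ?cdf_of_homo // !ltW.
Qed.

(** F(X) is uniform on [0, 1]. [F] may be constant on intervals, so no inverse is used: a point [c]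
    with a prescribed value [F c] is enough to compare with the event X <= c. *)
Lemma prob_cdf_of_lt s : 0 <= s <= 1 -> P [set w | F (X w) < s] = s%:E.
Proof.
move=> /andP[s0 s1].
have [p pE] : exists p, P [set w | F (X w) < s] = p%:E.
  by exists (fine (P [set w | F (X w) < s])); rewrite fineK // fin_num_measure.
have p0 : 0 <= p by rewrite -lee_fin -pE.
have p1 : p <= 1 by rewrite -lee_fin -pE probability_le1.
rewrite pE; congr (_%:E); apply/eqP; rewrite eq_le; apply/andP; split.
  have [s1'|s1'] := ltP s 1; last exact: le_trans s1'.
  have [s0'|s0'] := ltP 0 s.
    (* By monotonicity F(X) < s = F(c) forces X <= c, an event of probability s. *)
    have [|c Fc] := @cdf_of_attains s; first by rewrite s0'.
    rewrite -lee_fin -pE -Fc cdfE; apply: le_measure; rewrite ?inE //.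
      rewrite (_ : [set _ | _] = X @^-1` `]-oo, c]); first exact: mX.
      by apply/seteqP; split => w; rewrite /= in_itv.
    move=> w /= Fw; rewrite leNgt; apply/negP => /ltW.
    by move=> /cdf_of_homo; rewrite leNgt Fw.
  rewrite -lee_fin -pE (_ : [set _ | _] = set0) ?measure0 //.
  by apply/seteqP; split => w //=; rewrite ltNge (le_trans s0') // cdf_of_ge0.
(* If p < s, take F(c) = t strictly between them: X <= c forces F(X) <= t < s, hence t <= p, a
   contradiction. *)
rewrite leNgt; apply/negP => ps; pose t := (p + s) / 2.
have [|c Fc] := @cdf_of_attains t; first by apply/andP; split; rewrite /t; lra.
suff : t <= p by rewrite /t; lra.
rewrite -lee_fin -pE -Fc cdfE; apply: le_measure; rewrite ?inE //.
  rewrite (_ : [set _ | _] = X @^-1` `]-oo, c]); first exact: mX.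
  by apply/seteqP; split => w; rewrite /= in_itv.
move=> w /= /cdf_of_homo; rewrite -/F Fc => /le_lt_trans; apply.
by rewrite /t; lra.
Qed.

Lemma prob_cdf_of_ge s : 0 <= s <= 1 -> P [set w | s <= F (X w)] = (1 - s)%:E.
Proof.
move=> s01; rewrite (_ : [set _ | _] = ~` [set w | F (X w) < s]).
  by rewrite probability_setC // prob_cdf_of_lt.
by apply/seteqP; split => w /=; rewrite leNgt => /negP.
Qed.

Lemma prob_cdf_of_itv s t : 0 <= s -> s <= t -> t <= 1 ->
  P [set w | s <= F (X w) < t] = (t - s)%:E.
Proof.
move=> s0 st t1.
rewrite (_ : [set _ | _] = [set w | F (X w) < t] `\` [set w | F (X w) < s]).
  rewrite measureD // ?(le_lt_trans (probability_le1 _ _)) ?ltry //.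
  rewrite setIidr; last by move=> w /= /lt_le_trans; apply.
  rewrite EFinB -(@prob_cdf_of_lt t) -?(@prob_cdf_of_lt s) ?s0 ?t1 //.
    exact: le_trans st t1.
  by rewrite (le_trans s0 st).
apply/seteqP; split => w /=; first by case/andP; rewrite leNgt => /negP.
by case=> -> /negP; rewrite -leNgt => ->.
Qed.

Lemma prob_itv_cdf_of a b : a <= b ->
  P [set w | a < X w <= b] = (F b - F a)%:E.
Proof.
move=> ab; have mle x : measurable [set w | X w <= x].
  rewrite (_ : [set _ | _] = X @^-1` `]-oo, x]); first exact: mX.
  by apply/seteqP; split => w; rewrite /= in_itv.
rewrite (_ : [set _ | _] = [set w | X w <= b] `\` [set w | X w <= a]).
  rewrite measureD // ?(le_lt_trans (probability_le1 _ _)) ?ltry //.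
  rewrite setIidr; first by rewrite EFinB !cdfE.
  by move=> w /= /le_trans; apply.
apply/seteqP; split => w /=; first by case/andP; rewrite ltNge => /negP.
by case=> -> /negP; rewrite -ltNge => ->.
Qed.

End uniform_cdf.

(** * Law of the range of i.i.d. uniform variables *)

Section range_of_uniforms.
Context d (T : measurableType d) (R : realType) (P : probability T R).
Variables (n : nat) (U : 'I_n.+1 -> T -> R) (r : R).
Hypotheses (r01 : 0 < r < 1) (mU : forall i, measurable_fun setT (U i)).
Hypothesis U_ge0 : forall i w, 0 <= U i w.
(** Independence and uniformity enter only through the next two box probabilities. *)
Hypothesis PU_itv : forall x y, 0 <= x -> x <= y -> y <= 1 ->
  P [set w | forall i, x <= U i w < y] = ((y - x) ^+ n.+1)%:E.
Hypothesis PU_ge : forall x, 0 <= x <= 1 ->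
  P [set w | forall i, x <= U i w] = ((1 - x) ^+ n.+1)%:E.

(** The range is below [r] and the minimum is at least [x]. These events decrease in [x], so their
    differences localise the minimum. *)
Let E x := [set w | (forall i, x <= U i w) /\ (forall i j, U i w - U j w < r)].
Let B x y := [set w | forall i, x <= U i w < y].

Let m_forall (I : finType) (A : I -> set T) :
  (forall i, measurable (A i)) -> measurable [set w | forall i, A i w].
Proof.
move=> mA; rewrite (_ : [set _ | _] = \bigcap_(i in setT) A i).
  by apply: fin_bigcap_measurable => // i _; exact: mA.
by apply/seteqP; split => w /= H i //; exact: H.
Qed.

Let m_bool (f : T -> bool) : measurable_fun setT f -> measurable [set w | f w].
Proof.
move=> mf; rewrite (_ : [set _ | _] = setT `&` f @^-1` [set true]) ?setTI //.
by rewrite -[X in measurable X]setTI; exact: mf.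
Qed.

Let mge x : measurable [set w | forall i, x <= U i w].
Proof.
apply: (m_forall (A := fun i => [set w | x <= U i w])) => i.
by apply: m_bool; exact: measurable_fun_ler.
Qed.

Let mB x y : measurable (B x y).
Proof.
apply: (m_forall (A := fun i => [set w | x <= U i w < y])) => i.
apply: m_bool; apply: measurable_and; first exact: measurable_fun_ler.
exact: measurable_fun_ltr.
Qed.

Lemma measurable_range_lt : measurable [set w | forall i j, U i w - U j w < r].
Proof.
apply: (m_forall (A := fun i => [set w | forall j, U i w - U j w < r])) => i.
apply: (m_forall (A := fun j => [set w | U i w - U j w < r])) => j.
by apply: m_bool; apply: measurable_fun_ltr => //; exact: measurable_funB.
Qed.

Let mE x : measurable (E x).
Proof. exact: measurableI (mge x) measurable_range_lt. Qed.

Let fineD C D : measurable C -> measurable D -> D `<=` C ->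
  fine (P (C `\` D)) = fine (P C) - fine (P D).
Proof.
move=> mC mD DC; rewrite measureD ?(le_lt_trans (probability_le1 _ _)) ?ltry //.
by rewrite setIidr // fineB // fin_num_measure.
Qed.

Let fine_le C D : measurable C -> measurable D -> C `<=` D ->
  fine (P C) <= fine (P D).
Proof.
move=> mC mD CD; rewrite fine_le ?fin_num_measure //.
by apply: le_measure; rewrite ?inE.
Qed.

Let fine_B x y : 0 <= x -> x <= y -> y <= 1 ->
  fine (P (B x y)) = (y - x) ^+ n.+1.
Proof. by move=> *; rewrite PU_itv. Qed.

(* On [E x `\` E (x + h)] the minimum of the [U i] lies in [x, x + h[. *)
Let slice x h : 0 <= x -> 0 <= h <= r -> x + h + r <= 1 ->
  n.+1%:R * (r - h) ^+ n * h <= fine (P (E x)) - fine (P (E (x + h)))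
    <= n.+1%:R * (r + h) ^+ n * h.
Proof.
move=> x0 /andP[h0 hr] xhr; have r0 : 0 < r by case/andP: r01.
have EE : E (x + h) `<=` E x.
  by move=> w [H ?]; split=> // i; apply: le_trans (H i); rewrite lerDl.
rewrite -fineD //; apply/andP; split.
  have /andP[+ _] := @diff_exprn_bounds R (r - h) r n ltac:(lra).
  rewrite (_ : r - (r - h) = h); last by ring.
  move=> /le_trans; apply.
  have BB : B (x + h) (x + r) `<=` B x (x + r).
    by move=> w H i; have /andP[? ->] := H i; rewrite andbT; lra.
  have -> : r ^+ n.+1 - (r - h) ^+ n.+1 =
      fine (P (B x (x + r) `\` B (x + h) (x + r))).
    by rewrite fineD // !fine_B; try lra; congr (_ ^+ _ - _ ^+ _); ring.
  apply: fine_le; [exact: measurableD|exact: measurableD|].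
  (* All [U i] lie in an interval of length [r], half-open, so the range is below [r]; not all of
     them reach x + h. *)
  move=> w [Bw nBw]; split; first split=> [i|i j].
  - by have /andP[] := Bw i.
  - by have := Bw i; have := Bw j; lra.
  - by case=> H _; apply: nBw => i; rewrite H; have /andP[] := Bw i.
have /andP[_] := @diff_exprn_bounds R r (r + h) n ltac:(lra).
rewrite (_ : r + h - r = h); last by ring.
apply: le_trans.
have BB : B (x + h) (x + h + r) `<=` B x (x + h + r).
  by move=> w H i; have /andP[? ->] := H i; rewrite andbT; lra.
have -> : (r + h) ^+ n.+1 - r ^+ n.+1 =
    fine (P (B x (x + h + r) `\` B (x + h) (x + h + r))).
  by rewrite fineD // !fine_B; try lra; congr (_ ^+ _ - _ ^+ _); ring.
apply: fine_le; [exact: measurableD|exact: measurableD|].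
move=> w [[xU spr] nE]; split; last first.
  by move=> H; apply: nE; split=> // i; have /andP[] := H i.
(* Some [U j] is below x + h, and the range condition then keeps every [U i] below x + h + r. *)
have [j Uj] : exists j, U j w < x + h.
  apply: contrapT => nj; apply: nE; split=> // i.
  by rewrite leNgt; apply/negP => Ui; apply: nj; exists i.
by move=> i; rewrite xU /=; have := spr i j; lra.
Qed.

(** Telescoping sum of [k] slices of width [h]; the bounds of a slice do not depend on its
    position. *)
Let slices h k : 0 <= h <= r -> k%:R * h + r <= 1 ->
  k%:R * h * (n.+1%:R * (r - h) ^+ n) <=
    fine (P (E 0)) - fine (P (E (k%:R * h)))
    <= k%:R * h * (n.+1%:R * (r + h) ^+ n).
Proof.
move=> hr; have /andP[h0 _] := hr; elim: k => [|k IH].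
  by rewrite !mul0r subrr lexx.
rewrite -natr1 mulrDl mul1r => khr.
have kh0 : 0 <= k%:R * h by rewrite mulr_ge0.
have := IH ltac:(lra); have := slice kh0 hr khr.
by move: (_ * (r - h) ^+ n) (_ * (r + h) ^+ n) => ? ?; lra.
Qed.

(** The [U i] may equal 1, so the event is sandwiched between the boxes with right end open at 1 and
    unbounded; both have probability r^(n+1). *)
Let slice_last : fine (P (E (1 - r))) = r ^+ n.+1.
Proof.
have /andP[r0 r1] := r01.
apply/eqP; rewrite eq_le; apply/andP; split.
  rewrite -[r in leRHS](subKr 1) -[leRHS]/(fine (_%:E)) -PU_ge; last by lra.
  by apply: fine_le => // w [].
rewrite -[r in leLHS](subKr 1) -[leLHS]/(fine (_%:E)) -PU_itv; try lra.
apply: (@fine_le (B (1 - r) 1)) => // w H; split=> [i|i j]; first by have /andP[] := H i.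
by have := H i; have := H j; lra.
Qed.

Lemma range_uniform_lt : P [set w | forall i j, U i w - U j w < r] =
  (r ^+ n * (1 + n%:R * (1 - r)))%:E.
Proof.
have /andP[r0 r1] := r01.
have -> : [set w | forall i j, U i w - U j w < r] = E 0.
  by apply/seteqP; split => w /=; [split|case].
rewrite -[LHS]fineK ?fin_num_measure //; congr (_%:E).
(* Adding the last slice gives r^n (r + (n+1)(1 - r)) = r^n (1 + n (1 - r)). *)
suff : fine (P (E 0)) - fine (P (E (1 - r))) = (1 - r) * (n.+1%:R * r ^+ n).
  by rewrite slice_last exprS -natr1 => H; nra.
set V := _ - _.
(* With this mesh, k+1 slices fill [0, 1 - r] exactly. The bounds hold once [h k] is below [r], and
   both tend to [f r]. *)
pose h k : R := (1 - r) * k.+1%:R^-1.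
have h0 : h k @[k --> \oo] --> (0 : R).
  by rewrite -(mulr0 (1 - r)); apply: cvgM; [exact: cvg_cst|exact: cvg_harmonic].
have hk k : k.+1%:R * h k = 1 - r by rewrite /h mulrCA divff ?mulr1 // pnatr_eq0.
have hge0 k : 0 <= h k by rewrite mulr_ge0 // subr_ge0 ltW.
have bnd : \forall k \near \oo,
    (1 - r) * (n.+1%:R * (r - h k) ^+ n) <= V
      <= (1 - r) * (n.+1%:R * (r + h k) ^+ n).
  have : \forall k \near \oo, h k < r by exact: cvgr_lt h0 _ r0.
  apply: filterS => k hr.
  have := @slices (h k) k.+1; rewrite hk => -> //; last by lra.
  by rewrite hge0 ltW.
pose f z : R := (1 - r) * (n.+1%:R * z ^+ n).
have cf : continuous f.
  move=> z; apply: cvgM; first exact: cvg_cst.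
  apply: cvgM; [exact: cvg_cst|exact: exprn_continuous].
have rDh : f (r + h k) @[k --> \oo] --> f r.
  rewrite -[X in _ --> f X]addr0; apply: (cvg_comp (fun k => r + h k) f); last exact: cf.
  by apply: cvgD => //; exact: cvg_cst.
have rBh : f (r - h k) @[k --> \oo] --> f r.
  rewrite -[X in _ --> f X]subr0; apply: (cvg_comp (fun k => r - h k) f); last exact: cf.
  by apply: cvgB => //; exact: cvg_cst.
apply/eqP; rewrite eq_le; apply/andP; split.
  by apply: (cvgr_to_ge rDh); apply: filterS bnd => k /andP[].
by apply: (cvgr_to_le rBh); apply: filterS bnd => k /andP[].
Qed.

End range_of_uniforms.

(** * From the samples to the law of [q] *)

Section samples.
Context (R : realType) (n : nat) (Q : set (n.-tuple R)) (u : n.-tuple R -> R).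
Context d (T : measurableType d) (Pq : probability T R).
Variable q : {RV Pq >-> n.-tuple R}.
Context d' (Omega : measurableType d') (P : probability Omega R).
Variables (N : nat) (qs : 'I_N -> {RV P >-> n.-tuple R}).
Hypotheses (mQ : measurable Q) (mfu : measurable_fun Q u).
Hypotheses (qQ : forall t, Q (q t)) (qsQ : forall i w, Q (qs i w)).

Lemma measurable_comp_valued d1 (T1 : measurableType d1) (P1 : probability T1 R)
    (X : {RV P1 >-> n.-tuple R}) :
  (forall t, Q (X t)) -> measurable_fun setT (u \o X).
Proof.
move=> XQ; apply: (measurable_comp mQ) => //.
by move=> _ [t _ <-].
Qed.

Hypothesis qs_q : forall i, identically_distributed (qs i) q.
Hypothesis indep : mutually_independent qs.

Lemma prob_iid_forall (F : R -> R) (A : set R) :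
  measurable_fun setT F -> measurable A ->
  P [set w | forall i, A (F (u (qs i w)))] =
  (\prod_(i < N) Pq [set t | A (F (u (q t)))])%E.
Proof.
(* Intersecting with [Q] makes the preimage measurable and leaves the events unchanged, as [q] and
   all samples take values in [Q]. *)
move=> mF mA; pose G := Q `&` (F \o u) @^-1` A.
have mG : measurable G.
  by apply: (measurableT_comp mF mfu).
have := indep [set: 'I_N]%SET (fun=> mG).
rewrite (_ : \bigcap_(i in _) _ = [set w | forall i, A (F (u (qs i w)))]).
  move=> ->; rewrite big_mkcond /=; apply: eq_bigr => i _; rewrite inE.
  have := qs_q i mG; rewrite /distribution /pushforward => ->.
  by congr (Pq _); apply/seteqP; split=> t //= [].
apply/seteqP; split => w /= H i; first by have [] := H i ltac:(by rewrite /= inE).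
by move=> _; split => //; exact: H.
Qed.

End samples.

(** * The equivalence for the extreme order statistics *)

Theorem corollary1 (R : realType) (n : nat) (Q : set (n.-tuple R))
    (u : n.-tuple R -> R)
    (d : measure_display) (T : measurableType d) (Pq : probability T R)
    (q : {RV Pq >-> n.-tuple R})
    (d' : measure_display) (Omega : measurableType d')
    (P : probability Omega R)
    (N : nat) (qs : 'I_N -> {RV P >-> n.-tuple R}) (eps delta : R) :
  compact_tuple Q ->
  (forall t, Q (q t)) ->
  has_density q ->
  measurable_fun Q u ->
  (1 <= N)%N ->
  (forall i w, Q (qs i w)) ->
  (forall i, identically_distributed (qs i) q) ->
  mutually_independent qs ->
  continuous (cdf_of Pq (u \o q)) ->
  0 < eps < 1 ->
  0 < delta < 1 ->
  let u_hat k w := order_stat (fun i => u (qs i w)) k in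
  (((1 - delta)%:E <=
      P [set w | ((1 - eps)%:E <=
        Pq [set t | (u_hat 1%N w < u (q t) <= u_hat N w)%R])%E])%E
    <-> mu eps N <= delta)
  /\ (forall M M' : nat, (1 <= M)%N -> (M < M')%N -> mu eps M' < mu eps M).
Proof.
move=> cQ qQ _ mfu N1 qsQ qs_q indep cF e01 d01 u_hat.
split; last by move=> M M'; exact: mu_decreasing.
have mQ := compact_tuple_measurable cQ.
pose X : {RV Pq >-> R} :=
  HB.pack (u \o q) (isMeasurableFun.Build _ _ _ _ _ (measurable_comp_valued mQ mfu qQ)).
pose F := cdf_of Pq X.
have cX : continuous F := cF.
have mF : measurable_fun setT F := measurable_cdf_of X.
(* From here [N] is the sample size minus one, which is the exponent in [mu]. *)
case: N => [//|N] in N1 qs qsQ qs_q indep u_hat *.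
pose U i w := F (u (qs i w)).
have r01 : 0 < 1 - eps < 1 by lra.
have mU i : measurable_fun setT (U i).
  exact: (measurableT_comp mF (measurable_comp_valued mQ mfu (qsQ i))).
have iid A : measurable A ->
    P [set w | forall i, A (U i w)] = (\prod_(i < N.+1) Pq [set t | A (F (X t))])%E.
  exact: (prob_iid_forall mQ mfu qQ qsQ qs_q indep mF).
have prodE (x : R) : (\prod_(i < N.+1) x%:E = (x ^+ N.+1)%:E)%E.
  by rewrite prodEFin prodr_const card_ord.
have mco (x y : R) : measurable [set t : R | x <= t < y].
  rewrite (_ : mkset _ = `[x, y[%classic); first exact: measurable_itv.
  by apply/seteqP; split => t; rewrite /= in_itv.
have mge (x : R) : measurable [set t : R | x <= t].
  rewrite (_ : mkset _ = `[x, +oo[%classic); first exact: measurable_itv.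
  by apply/seteqP; split => t; rewrite /= in_itv /= andbT.
have rU : P [set w | forall i j, U i w - U j w < 1 - eps] = (mu eps N.+1)%:E.
  rewrite (range_uniform_lt r01 mU); first by rewrite /mu subKr.
  - by move=> i w; exact: cdf_of_ge0.
  - move=> x y x0 xy y1; rewrite -prodE -(prob_cdf_of_itv cX x0 xy y1).
    by rewrite -(iid _ (mco x y)).
  - move=> x x01; rewrite -prodE -(prob_cdf_of_ge cX x01).
    by rewrite -(iid _ (mge x)).
(* The outer event is the complement of a range below 1 - eps, so its probability is 1 - mu. *)
rewrite [X in P X](_ : _ =
    ~` [set w | forall i j, U i w - U j w < 1 - eps]).
  rewrite probability_setC ?rU; first by rewrite -EFinB lee_fin; split; lra.
  exact: measurable_range_lt.
apply/seteqP; split => w /=; set x := fun i => u (qs i w).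
  have b i := order_stat_bounds x i; have /andP[b1 b2] := b ord0.
  rewrite (prob_itv_cdf_of X (le_trans b1 b2)) lee_fin.
  (* The extremes are attained at samples [i] and [j], so the inner probability is U i - U j. *)
  have [i ->] := @order_statP R N.+1 x N.+1 ltac:(by rewrite leqnn).
  have [j ->] := @order_statP R N.+1 x 1 ltac:(by []).
  by move=> ij H; have := H i j; rewrite ltNge ij.
(* Conversely, by monotonicity of [F], the inner probability bounds every U i - U j from above. *)
move=> H; rewrite leNgt; apply/negP => H'; apply: H => i j.
have /andP[_ iN] := order_stat_bounds x i.
have /andP[j1 jN] := order_stat_bounds x j.
move: H'; rewrite (prob_itv_cdf_of X (le_trans j1 jN)) lte_fin; apply: le_lt_trans.
by apply: lerB; exact: cdf_of_homo.
Qed.
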